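(* Let $k>2$ be an even number and let $n>2k$ be an integer with $n\equiv 0,\ 2,\ k-1$ or $k+1 \pmod{2k}$. Then $$\alpha(P(n,k)) = \left\lfloor \frac{(2k-1)n}{2k}\right\rfloor .$$
   Context: For positive integers $n,k$ with $n>2k$, the generalized Petersen graph $P(n,k)$ is the graph with vertex set $\{u_i,v_i : i=1,\dots,n\}$ (so $2n$ vertices) and edge set $\{u_iu_{i+1},\ u_iv_i,\ v_iv_{i+k} : i=1,\dots,n\}$, subscripts being reduced modulo $n$. For a graph $G$, $\alpha(G)$ denotes the independence number, i.e. the size of a largest set of pairwise non-adjacent vertices. *)

(* Defs.v *)
From mathcomp Require Import all_boot.

Set Implicit Arguments.
Unset Strict Implicit.
Unset Printing Implicit Defensive.

(* A graph is given by its adjacency relation on a finite type of vertices.   *)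

Definition independent (T : finType) (e : rel T) (A : {set T}) : bool :=
  [forall x in A, forall y in A, ~~ e x y].

Definition independence_number (T : finType) (e : rel T) : nat :=
  \max_(A : {set T} | independent e A) #|A|.

(* P(n, k): inl i is the outer vertex u_i and inr i the inner vertex v_i.     *)
(* Subscripts are residues modulo n, represented by 0, ..., n - 1 instead of  *)
(* 1, ..., n.                                                                 *)

Definition gpetersen_vertex (n : nat) : finType := ('I_n + 'I_n)%type.

Definition gpetersen_arc (n k : nat) : rel (gpetersen_vertex n) :=
  fun x y =>
    match x, y with
    | inl i, inl j => j == i + 1 %[mod n]
    | inl i, inr j => i == j
    | inr i, inr j => j == i + k %[mod n]
    | inr _, inl _ => false
    end.

Definition gpetersen (n k : nat) : rel (gpetersen_vertex n) :=
  fun x y => gpetersen_arc k x y || gpetersen_arc k y x.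

Lemma gpetersen_sym (n k : nat) : symmetric (@gpetersen n k).
Proof. by move=> x y; rewrite /gpetersen orbC. Qed.

Lemma gpetersen_irr (n k : nat) :
  0 < k -> 2 * k < n -> irreflexive (@gpetersen n k).
Proof.
move=> k_gt0 lt2kn x; rewrite /gpetersen orbb.
have aux d (i : 'I_n) : 0 < d < n -> (i == i + d %[mod n]) = false.
  case/andP=> d_gt0 lt_dn.
  by rewrite -{1}[nat_of_ord i]addn0 eqn_modDl mod0n modn_small // eq_sym -leqn0 leqNgt d_gt0.
have lt_kn: k < n by apply: leq_ltn_trans lt2kn; rewrite leq_pmull.
by case: x => i /=; rewrite aux // ?k_gt0 //= (leq_ltn_trans k_gt0).
Qed.

(* Main.v *)
Require Import Defs.
From mathcomp Require Import all_boot.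
From mathcomp Require Import zify.

(** For an independent set, call index i a gap if neither u_i nor v_i is
    chosen; the chosen set has at most n - #gaps elements.  Upper bound: read
    indices periodically and count gaps in windows of length 2k.  A gapless
    window is forced to be UVUV..UV VUVU..VU, which forces the next index to
    be a gap; from then on, as long as windows contain exactly one gap, the
    gaps recur with period 2k and no gapless window can appear.  Hence between
    two gapless windows there is one with at least two gaps, windows contain
    at least one gap on average, and n <= 2k #gaps.  Lower bound: repeat the
    block -VUV..V VUVU..VU of length 2k (- is the gap) and force the last of
    the n letters to be U; for the four residues of n this word closes up. *)

Set Implicit Arguments.
Unset Strict Implicit.
Unset Printing Implicit Defensive.

(** * Gaps of words in the letters U and V *)

Section Word.

Variables (k : nat) (U V : nat -> bool).
Hypotheses (k_gt2 : 2 < k) (k_even : ~~ odd k).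
Hypothesis UU : forall i, U i -> ~~ U i.+1.
Hypothesis VV : forall i, V i -> ~~ V (i + k).

Definition gap i := ~~ U i && ~~ V i.

Definition window_gaps t := \sum_(j < 2 * k) gap (t + j).

(* The state of the word at a gap [p + k] that makes the next gapless stretch
   unable to exceed 2k - 1 letters. *)
Definition locked p :=
  gap (p + k) /\ forall j, ~~ odd j -> 0 < j < k -> V (p + j).

Definition locked_window t := exists2 p, t <= p + k < t + 2 * k & locked p.

Lemma window_gaps0P t :
  reflect (forall j, j < 2 * k -> ~~ gap (t + j)) (window_gaps t == 0).
Proof.
rewrite /window_gaps sum_nat_eq0; apply: (iffP forallP) => [h j ltj | h j].
  by have := h (Ordinal ltj); rewrite /= eqb0.
by rewrite /= eqb0 h.
Qed.

Lemma window_gaps_le1 t p j :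
    window_gaps t <= 1 -> t <= p < t + 2 * k -> gap p ->
  t <= j < t + 2 * k -> j != p -> ~~ gap j.
Proof.
move=> le1 p_in gap_p j_in neq_jp; apply/negP => gap_j.
have ltp : p - t < 2 * k by lia.
have ltj : j - t < 2 * k by lia.
have neq : Ordinal ltj != Ordinal ltp by apply/eqP => -[]; lia.
move: le1; rewrite /window_gaps (bigD1 (Ordinal ltp)) //=.
rewrite (bigD1 (Ordinal ltj)) //=.
by rewrite !subnKC ?gap_p ?gap_j //; lia.
Qed.

Lemma gapless_VU i : ~~ gap (i + k) -> V i -> U (i + k).
Proof. by rewrite /gap => /nandP[] /negPn // + /VV /negP. Qed.

Lemma gapless_NUV i : ~~ gap i -> ~~ U i -> V i.
Proof. by rewrite /gap => /nandP[] /negPn // ->. Qed.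

Lemma UU_pred i : U i.+1 -> ~~ U i.
Proof. by apply: contraL => /UU. Qed.

Lemma locked_window_gap t : locked_window t -> 0 < window_gaps t.
Proof.
case=> p p_in [gap_p _]; rewrite lt0n; apply/negP => /window_gaps0P h.
have /h : p + k - t < 2 * k by lia.
by rewrite subnKC ?gap_p //; lia.
Qed.

Lemma UV_gap p : V (p + 0) -> U (p + k.-1) -> gap (p + k).
Proof.
rewrite addn0 => /VV nV /UU nU; rewrite /gap nV andbT.
by have -> : p + k = (p + k.-1).+1 by lia.
Qed.

(** Each even offset below [k] precedes a U, hence is V. Then V at [p] and U at [p + k - 1] exclude
    both letters at [p + k]. *)
Lemma odd_U_locked p :
    (forall j, odd j -> j < k -> U (p + j)) ->
    (forall j, j < k -> ~~ gap (p + j)) -> locked p.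
Proof.
move=> oddU ng.
have evenV j : ~~ odd j -> j < k -> V (p + j).
  move=> nodd ltj; apply: gapless_NUV; first exact: ng.
  by apply: UU_pred; rewrite -addnS; apply: oddU; lia.
split; last by move=> j nodd /andP[_]; exact: evenV.
by apply: UV_gap; [apply: evenV; lia | apply: oddU; lia].
Qed.

Lemma gapless_window_locked t : window_gaps t = 0 -> locked (t + k).
Proof.
move=> /eqP/window_gaps0P ng.
(* Two consecutive V's would force two consecutive U's at distance [k]. *)
have alt j : j.+1 < k -> U (t + j.+1) = ~~ U (t + j).
  move=> ltj; rewrite addnS; case Uj: (U (t + j)); first exact/negbTE/UU.
  apply/negPn/negP => nU.
  have Ujk : U (t + j + k).
    apply: gapless_VU; first by rewrite -addnA; apply: ng; lia.
    by apply: gapless_NUV; rewrite ?Uj //; apply: ng; lia.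
  have := UU Ujk; rewrite -addSn => /negP[]; apply: gapless_VU.
    by rewrite -addnS -addnA; apply: ng; lia.
  by apply: gapless_NUV => //; rewrite -addnS; apply: ng; lia.
have altE j : j < k -> U (t + j) = odd j (+) U t.
  elim: j => [|j IHj] ltj; first by rewrite addn0.
  by rewrite alt // IHj ?oddS ?addNb //; lia.
(* Otherwise [t + k - 1] and [t + k] would both be U, as [k - 1] is odd. *)
have Ut : U t.
  apply/negPn/negP => nU.
  have Uk : U (t + k).
    apply: gapless_VU; first by apply: ng; lia.
    by apply: gapless_NUV => //; rewrite -(addn0 t); apply: ng; lia.
  have : U (t + k.-1) by rewrite altE ?(negbTE nU) ?addbF; lia.
  by move=> /UU; rewrite -addnS prednK ?Uk //; lia.
apply: odd_U_locked => j; last by move=> ltj; rewrite -addnA; apply: ng; lia.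
move=> oddj ltj.
rewrite addnAC; apply: gapless_VU; first by rewrite -addnA; apply: ng; lia.
apply: gapless_NUV; first by apply: ng; lia.
by rewrite altE // oddj Ut.
Qed.

(** Shifting by [k] turns the V's at even offsets into U's, whose neighbours are V's at odd offsets;
    a second shift turns these into U's. *)
Lemma locked_next p :
    locked p -> (forall j, 0 < j < 2 * k -> ~~ gap (p + k + j)) ->
  locked (p + k + k).
Proof.
move=> [_ evenV] ng.
have evenU j : ~~ odd j -> 0 < j < k -> U (p + k + j).
  move=> nodd ltj; rewrite addnAC; apply: gapless_VU; last exact: evenV.
  by rewrite addnAC; apply: ng; lia.
have oddV j : odd j -> j < k -> V (p + k + j).
  move=> oddj ltj; apply: gapless_NUV; first by apply: ng; lia.
  have [lt1k|gek] := ltnP j.+1 k.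
    by apply: UU_pred; rewrite -addnS; apply: evenU; lia.
  (* Here [j = k - 1]: only the left neighbour is known to be U, at offset [k - 2 > 0]. *)
  have -> : p + k + j = (p + k + j.-1).+1 by lia.
  by apply: UU; apply: evenU; lia.
apply: odd_U_locked => j; last by move=> ltj; rewrite -addnA; apply: ng; lia.
move=> oddj ltj.
rewrite addnAC; apply: gapless_VU; last exact: oddV.
by rewrite -addnA; apply: ng; lia.
Qed.

Lemma locked_window0 t : window_gaps t = 0 -> locked_window t.+1.
Proof. by move=> /gapless_window_locked; exists (t + k) => //; lia. Qed.

Lemma locked_window1 t :
  locked_window t -> window_gaps t = 1 -> locked_window t.+1.
Proof.
move=> [p p_in lp] W1; have [ltp|gep] := ltnP t (p + k).
  by exists p => //; lia.
(* The locking gap is at [t] and leaves the window; its successor enters at [t + 2 * k]. *)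
exists (p + k + k); first by lia.
apply: locked_next => // j j_in.
by apply: (@window_gaps_le1 t (p + k)); rewrite ?W1 //; [case: lp | lia | lia].
Qed.

(* The sum lags behind [N], by 1, only while the current window is locked. *)
Lemma sum_window_gaps N : N <= (\sum_(t < N) window_gaps t).+1.
Proof.
suff: N <= \sum_(t < N) window_gaps t \/
      N <= (\sum_(t < N) window_gaps t).+1 /\ locked_window N by lia.
elim: N => [|N IHN]; first by left.
rewrite big_ord_recr /=; move: (\sum_(t < N) window_gaps t) IHN => S IHN.
case W: (window_gaps N) => [|[|w]].
- right; split; last exact: locked_window0.
  by case: IHN => [|[_ /locked_window_gap]]; rewrite ?W; lia.
- case: IHN => [le|[le lw]]; [left; lia | right].
  by split; [lia | exact: locked_window1].
- by left; lia.
Qed.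

Lemma periodic_gaps n :
    (forall i, gap (i + n) = gap i) ->
  n <= 2 * k * \sum_(i < n) gap i.
Proof.
move=> per.
have shift j : \sum_(t < n) gap (t + j) = \sum_(t < n) gap t.
  rewrite -(big_mkord xpredT (fun t => nat_of_bool (gap t))).
  rewrite -(big_mkord xpredT (fun t => nat_of_bool (gap (t + j)))).
  elim: j => [|j IHj]; first by under eq_bigr do rewrite addn0.
  (* With [gap j = gap (j + n)] added, both sides count the gaps from [j] to [j + n]. *)
  rewrite -IHj; apply/(@addnI (gap j)).
  under eq_bigr do rewrite addnS -addSn.
  have := @big_nat_recr _ 0 addn n 0 (fun i => nat_of_bool (gap (i + j))) isT.
  by rewrite big_nat_recl //= [n + j]addnC per [_ + gap j]addnC.
(* Over two periods the additive error 1 of [sum_window_gaps] is absorbed by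
   parity. *)
have := sum_window_gaps (2 * n).
rewrite /window_gaps exchange_big /=.
under eq_bigr => j _.
  rewrite mul2n -addnn big_split_ord /= shift.
  under [X in _ + X]eq_bigr => t _ do rewrite -addnA addnC per.
  rewrite shift; over.
by rewrite sum_nat_const card_ord; move: (\sum_(i < n) _) => z; lia.
Qed.

End Word.

(** * Upper bound for independent sets *)

Lemma card_vertices n (A : {set gpetersen_vertex n}) :
  #|A| = \sum_(i < n) ((inl i \in A) + (inr i \in A)).
Proof. by rewrite -sum1_card big_mkcond big_sumType big_split. Qed.

Lemma independentP (T : finType) (e : rel T) (A : {set T}) :
  reflect {in A &, forall x y, ~~ e x y} (independent e A).
Proof.
apply: (iffP forall_inP) => [h x y Ax | h x Ax].
  by have /forall_inP := h x Ax; exact.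
by apply/forall_inP => y; exact: h.
Qed.

Lemma independent_card_le n k (A : {set gpetersen_vertex n}) :
    2 < k -> ~~ odd k -> 2 * k < n -> independent (@gpetersen n k) A ->
  #|A| <= ((2 * k - 1) * n) %/ (2 * k).
Proof.
move=> k_gt2 k_even n_gt2k /independentP indA.
have n_gt0 : 0 < n by lia.
pose pt t := Ordinal (ltn_pmod t n_gt0).
pose U t := inl (pt t) \in A; pose V t := inr (pt t) \in A.
have UU i : U i -> ~~ U i.+1.
  move=> Ui; apply/negP => /(indA _ _ Ui) /norP[] /negP[] /=.
  by rewrite addn1 -[(_ %% n).+1]addn1 modnDml addn1 modn_mod.
have VV i : V i -> ~~ V (i + k).
  move=> Vi; apply/negP => /(indA _ _ Vi) /norP[] /negP[] /=.
  by rewrite modnDml modn_mod.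
have per i : gap U V (i + n) = gap U V i.
  have e : pt (i + n) = pt i by apply: val_inj; rewrite /= modnDr.
  by rewrite /gap /U /V e.
have gaps := periodic_gaps k_gt2 k_even UU VV per.
have card_gap : #|A| + \sum_(i < n) gap U V i <= n.
  rewrite card_vertices -big_split /= -[leqRHS]card_ord -sum1_card.
  apply: leq_sum => i _.
  have pti : pt i = i by apply: val_inj; rewrite /= modn_small.
  rewrite /gap /U /V pti; case Ai: (inl i \in A); case Bi: (inr i \in A) => //.
  by have := indA _ _ Ai Bi; rewrite /gpetersen /= eqxx.
by rewrite leq_divRL; move: (\sum_(i < n) _) gaps card_gap => z; nia.
Qed.

(** The right-hand side is the ceiling of [n / d]. *)
Lemma count_multiples d n :
  0 < d -> \sum_(i < n) (d %| i) = (n + d.-1) %/ d.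
Proof.
move=> d_gt0; elim: n => [|n IHn].
  by rewrite big_ord0 divn_small // prednK.
rewrite big_ord_recr /= IHn addSn divnS // -addnS prednK //.
by rewrite dvdn_addl // addnC.
Qed.

Lemma modn_add_cases d i j : j < d ->
  (i + j) %% d = if i %% d + j < d then i %% d + j else i %% d + j - d.
Proof.
move=> ltj; have lti : i %% d < d by rewrite ltn_mod; lia.
rewrite -modnDml; case: ltnP => [/modn_small //|led].
by rewrite -{1}(subnK led) modnDr modn_small //; lia.
Qed.

(** * Lower bound by an explicit word *)

Section Construction.

Variables (k n : nat).
Hypotheses (k_gt2 : 2 < k) (k_even : ~~ odd k) (n_gt2k : 2 * k < n).

Definition block_U i :=
  let b := i %% (2 * k) in (0 < b < k) && ~~ odd b || (k <= b) && odd b.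

Definition block_V i :=
  let b := i %% (2 * k) in (b < k) && odd b || (k <= b) && ~~ odd b.

(** A V at [n - 1] would clash with the V at [k - 1], its shift by [k] modulo [n]. *)
Definition word_U i := (i == n.-1) || block_U i.

Definition word_V i := (i != n.-1) && block_V i.

Definition word_set : {set gpetersen_vertex n} :=
  [set x : 'I_n + 'I_n |
    match x with inl i => word_U i | inr i => word_V i end].

Lemma block_UU i : block_U i -> ~~ block_U i.+1.
Proof.
have lti : i %% (2 * k) < 2 * k by rewrite ltn_mod; lia.
rewrite /block_U -[i.+1]addn1 modn_add_cases; last by lia.
by move: (i %% _) lti => b; case: ifP; lia.
Qed.

Lemma block_VV i : block_V i -> ~~ block_V (i + k).
Proof.
have lti : i %% (2 * k) < 2 * k by rewrite ltn_mod; lia.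
rewrite /block_V modn_add_cases; last by lia.
by move: (i %% _) lti => b; case: ifP; lia.
Qed.

Hypothesis n_mod : [\/ n = 0 %[mod 2 * k], n = 2 %[mod 2 * k],
                 n = k - 1 %[mod 2 * k] | n = k + 1 %[mod 2 * k]].

Lemma residue_cases :
  [\/ n %% (2 * k) = 0, n %% (2 * k) = 2,
      n %% (2 * k) = k - 1 | n %% (2 * k) = k + 1].
Proof.
have small j : j < 2 * k -> j %% (2 * k) = j := @modn_small _ _.
by case: n_mod => ->; rewrite small; try lia; constructor.
Qed.

(** The residue of [n - 2] is [2k - 2], [0], [k - 3] or [k - 1]: a V or a gap, so the U forced at
    [n - 1] fits. *)
Lemma block_U_last : ~~ block_U n.-2.
Proof.
have lti : n.-2 %% (2 * k) < 2 * k by rewrite ltn_mod; lia.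
have en : n %% (2 * k) = (n.-2 + 2) %% (2 * k) by congr (_ %% _); lia.
have := residue_cases; rewrite en.
rewrite /block_U modn_add_cases; last by lia.
by move: (n.-2 %% _) lti => b ltb; case: ifP => ? []; lia.
Qed.

(** Put [j = i + k - n < k - 1]. For each residue of [n], a V at [i] makes [j] even, but below [k]
    the V's sit at odd indices. *)
Lemma block_VV_wrap i :
  i.+1 < n -> n <= i + k -> block_V i -> ~~ block_V (i + k - n).
Proof.
move=> lt1 len; set j := i + k - n; have ltj : k + j < 2 * k by lia.
have ei : i %% (2 * k) = (n + (k + j)) %% (2 * k).
  by rewrite -(modnDr i); congr (_ %% _); lia.
rewrite /block_V ei (modn_add_cases _ ltj) (@modn_small j); last by lia.
have := residue_cases; move: (n %% _) => r r_cases.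
by case: r_cases => ->; case: ifP; lia.
Qed.

Lemma word_set_independent : independent (@gpetersen n k) word_set.
Proof.
have arc x y : x \in word_set -> y \in word_set -> ~~ gpetersen_arc k x y.
  rewrite !inE; case: x y => i [] j //=; have := ltn_ord i; have := ltn_ord j.
  - move=> ltj lti Ui Uj; rewrite (modn_small ltj).
    have [lt1|ge] := ltnP i.+1 n; last first.
      (* The outer cycle closes at index 0, which is a gap. *)
      have -> : i + 1 = n by lia.
      rewrite modnn; apply: contraL Uj => /eqP ->.
      by rewrite /word_U /block_U mod0n; lia.
    rewrite addn1 modn_small //; apply: contraL Ui => /eqP ej.
    move: Uj; rewrite /word_U ej; case: eqP => [eqn _|_ /=].
      have -> : (i : nat) = n.-2 by lia.
      by rewrite (negbTE block_U_last); lia.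
    move=> Ui1; apply/norP; split; first by lia.
    by apply: contraL Ui1; exact: block_UU.
  - move=> _ _ Ui Vi; apply: contraL Ui => /eqP ->.
    by move: Vi; rewrite /word_U /word_V /block_U /block_V; lia.
  - move=> ltj lti /andP[ni Vi] /andP[nj Vj]; rewrite (modn_small ltj).
    apply: contraL Vj => /eqP ->; have [lt1|ge] := ltnP (i + k) n.
      by rewrite modn_small ?block_VV.
    rewrite -(subnK ge) modnDr modn_small; last by lia.
    by apply: block_VV_wrap => //; lia.
apply/independentP => x y Ax Ay; rewrite /gpetersen negb_or.
by rewrite !arc.
Qed.

(** Gaps occur only at multiples of [2 * k], and [n] minus the ceiling of [n / 2k] is the floor of
    [(2k - 1)n / 2k]. *)
Lemma card_word_set : (2 * k - 1) * n %/ (2 * k) <= #|word_set|.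
Proof.
have card_gap : n <= #|word_set| + \sum_(i < n) (2 * k %| i).
  rewrite card_vertices -big_split /= -[leqLHS]card_ord -sum1_card.
  apply: leq_sum => i _; rewrite !inE /word_U /word_V /block_U /block_V /dvdn.
  by move: (_ %% _) => b; lia.
move: card_gap; rewrite count_multiples; last by lia.
have := leq_divM (n + (2 * k).-1) (2 * k).
move: (_ %/ _) => z zle zge; rewrite -ltnS ltn_divLR; last by lia.
by nia.
Qed.

End Construction.

Theorem proposition3 (k n : nat) (k_gt2 : 2 < k) (k_even : ~~ odd k)
    (n_gt2k : 2 * k < n)
    (n_mod : [\/ n = 0 %[mod 2 * k], n = 2 %[mod 2 * k],
                 n = k - 1 %[mod 2 * k] | n = k + 1 %[mod 2 * k]]) :
  independence_number (@gpetersen n k) = ((2 * k - 1) * n) %/ (2 * k).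
Proof.
apply/eqP; rewrite eqn_leq; apply/andP; split.
  by apply/bigmax_leqP => A; exact: independent_card_le.
apply: leq_trans (card_word_set k_gt2 k_even n_gt2k) _.
exact: leq_bigmax_cond (word_set_independent k_gt2 k_even n_gt2k n_mod).
Qed.
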